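(* Define $\alpha_2(\Delta)$ for integers $\Delta\ge1$ by \[ \alpha_2(\Delta)=\begin{cases}\frac14 & \text{if }\Delta=1,\\[2pt] \frac12-\frac{1}{2^{\Delta+2}}\binom{\Delta}{\Delta/2} & \text{if }\Delta\ge2\text{ and even},\\[2pt] \alpha_2(\Delta-1) & \text{if }\Delta\ge 3\text{ and odd}.\end{cases} \] Then on any finite directed graph $G$ without loops with maximum indegree $\Delta=\Delta(G)\ge 1$, the $2$-partition mechanism is $\alpha_2(\Delta)$-optimal, i.e., the vertex $i$ it selects from $G$ satisfies $\mathbb{E}[\delta^-(i,G)]\ge\alpha_2(\Delta)\,\Delta$.
   Context: Graphs are finite directed graphs $G=(N,E)$ with vertex set $N=\{1,\dots,n\}$, $n\ge 1$, and $E\subseteq\{(i,j)\in N\times N: i\ne j\}$. For $S\subseteq N$ and $i\in N$, $\delta^-_S(i)=|\{j\in S:(j,i)\in E\}|$ is the indegree of $i$ from $S$; $\delta^-(i,G)=\delta^-_N(i)$; and $\Delta(G)=\max_{i\in N}\delta^-(i,G)$. $2$-partition mechanism. On input $G=(N,E)$: assign each $i\in N$ independently and uniformly at random to one of two sets $A_1$ and $A_2$. If $A_2=\emptyset$, return a vertex chosen uniformly at random from $N$. Otherwise return a vertex chosen uniformly at random from $\arg\max_{i\in A_2}\delta^-_{A_1}(i)$. *)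

(* Defs.v *)
From HB Require Import structures.
From mathcomp Require Import all_boot all_order all_algebra.

Set Implicit Arguments.
Unset Strict Implicit.
Unset Printing Implicit Defensive.

Import Order.TTheory GRing.Theory Num.Theory.
Local Open Scope ring_scope.

(* A directed graph on the vertex set 'I_n is given by its edge relation      *)
(* [e : rel 'I_n]; [e j i] means that (j, i) is an edge.                      *)
Definition indeg_from (n : nat) (e : rel 'I_n) (S : {set 'I_n}) (i : 'I_n)
  : nat := #|[set j in S | e j i]|.

Definition indeg (n : nat) (e : rel 'I_n) (i : 'I_n) : nat :=
  indeg_from e [set: 'I_n] i.

Definition max_indeg (n : nat) (e : rel 'I_n) : nat :=
  (\max_(i < n) indeg e i)%N.

Definition argmax_from (n : nat) (e : rel 'I_n) (S T : {set 'I_n})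
  : {set 'I_n} :=
  [set i in T | [forall j in T, (indeg_from e S j <= indeg_from e S i)%N]].

Definition unif (R : realFieldType) (T : finType) (B : {set T}) (x : T) : R :=
  if x \in B then #|B|%:R^-1 else 0.

(* Distribution of the vertex selected once the assignment has been drawn:    *)
(* vertex i lies in A_2 if [a i] is true, and in A_1 otherwise.               *)
Definition select (R : realFieldType) (n : nat) (e : rel 'I_n)
    (a : {ffun 'I_n -> bool}) : 'I_n -> R :=
  let A1 := [set i | ~~ a i] in
  let A2 := [set i | a i] in
  if A2 == set0 then unif R [set: 'I_n] else unif R (argmax_from e A1 A2).

(* [two_partition R e i] is the probability that the mechanism selects i; the *)
(* inner product is the probability of the assignment [a], made of            *)
(* independent fair coin flips.                                               *)
Definition two_partition (R : realFieldType) (n : nat) (e : rel 'I_n)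
    (i : 'I_n) : R :=
  \sum_(a : {ffun 'I_n -> bool})
     (\prod_(j < n) unif R [set: bool] (a j)) * select R e a i.

Definition expectation (R : realFieldType) (T : finType) (P X : T -> R) : R :=
  \sum_(x : T) P x * X x.

(* The value at 0 is junk. *)
Fixpoint alpha2 (R : realFieldType) (d : nat) : R :=
  match d with
  | 0 => 0
  | 1 => 1 / 4
  | d'.+1 => if odd d then alpha2 R d'
             else 1 / 2 - 1 / 2 ^+ (d + 2) * 'C(d, d %/ 2)%:R
  end.

(* Main.v *)
(** Fix a vertex [v] of maximum indegree [d] and let [X] be its indegree from
    [A_1], which does not depend on the coin of [v]. Pair each assignment with
    the one obtained by flipping the coin of [v], and look at the one with
    [v] in [A_2]. If [v] is its only winner, the selected indegree is [d].
    Otherwise some other vertex of [A_2] has indegree at least [X] from [A_1],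
    so in both assignments of the pair every winner has indegree at least [X].
    Hence the two scores always add up to at least [min (2 X, d)], where [X] is
    binomial with parameters [d] and [1/2], and the expectation of
    [min (2 X, d) = d - (d - 2 X)^+] is computed by a telescoping sum. *)
Require Import Defs.
From mathcomp Require Import all_boot all_order all_algebra.
From mathcomp Require Import zify ring.

Import Order.TTheory GRing.Theory Num.Theory.
Local Open Scope ring_scope.

(** * Coin flips and the binomial law *)

Definition flip {T : finType} (v : T) (a : {ffun T -> bool}) :
  {ffun T -> bool} := [ffun i => if i == v then ~~ a v else a i].

Lemma flipK (T : finType) (v : T) : involutive (flip v).
Proof.
move=> a; apply/ffunP=> i; rewrite !ffunE eqxx.
by case: eqP => // ->; rewrite negbK.
Qed.

Lemma sum_flip (R : nmodType) (T : finType) (v : T)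
    (F : {ffun T -> bool} -> R) :
  (\sum_a F a) *+ 2 = \sum_a (F a + F (flip v a)).
Proof.
rewrite mulr2n big_split /=.
by rewrite [in X in _ + X = _](reindex_inj (inv_inj (flipK T v))).
Qed.

(** Pascal's rule, in the form that matches adding one coin in [sum_card_fibre]. *)
Lemma sum_binS (R : nmodType) (d : nat) (G : nat -> R) :
  \sum_(k < d.+2) G k *+ 'C(d.+1, k)
  = \sum_(k < d.+1) (G k + G k.+1) *+ 'C(d, k).
Proof.
rewrite big_ord_recl bin0.
under eq_bigr => k _ do rewrite lift0 binS mulrnDr.
rewrite big_split /= big_ord_recr /= bin_small // mulr0n addr0 addrA.
under [RHS]eq_bigr => k _ do rewrite mulrnDl.
rewrite [RHS]big_split /=; congr (_ + _).
by rewrite [RHS]big_ord_recl bin0.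
Qed.

(** The number of elements of [A] whose coin is false is binomial. The powers of 2 on both sides
    avoid division. Induction removes some [v] from [A] and pairs [a] with [flip v a]: exactly one
    of the two counts [v]. *)
Lemma sum_card_fibre (R : pzRingType) (T : finType) (A : {set T})
    (G : nat -> R) :
  (\sum_(a : {ffun T -> bool}) G #|[set j in A | ~~ a j]|) *+ 2 ^ #|A|
  = (\sum_(k < #|A|.+1) G k *+ 'C(#|A|, k)) *+ 2 ^ #|T|.
Proof.
have [d cardA] : exists d, #|A| = d by exists #|A|.
elim: d A G cardA => [|d IHd] A G cardA.
  rewrite cardA big_ord1 (cards0_eq cardA) bin0.
  under eq_bigr => a _.
    rewrite (_ : [set _ in _ | _] = set0) ?cards0; last first.
      by apply/setP => j; rewrite !inE.
    over.
  by rewrite sumr_const card_ffun card_bool.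
have [v vA] : exists v, v \in A by apply/card_gt0P; rewrite cardA.
have cardAv : #|A :\ v| = d by move: cardA; rewrite (cardsD1 v) vA => -[].
rewrite cardA sum_binS expnS mulrnA (sum_flip _ _ v).
have := IHd (A :\ v) (fun k => G k + G k.+1) cardAv.
rewrite cardAv => <-.
congr (_ *+ _); apply: eq_bigr => a _.
(* Flipping [v] swaps the two summands on the left and leaves the count over [A :\ v] unchanged. *)
wlog av : a / a v => [wl|].
  have [/wl //|nav] := boolP (a v).
  have := wl (flip v a); rewrite flipK addrC => ->; last by rewrite ffunE eqxx.
  have -> : [set j in A :\ v | ~~ flip v a j] = [set j in A :\ v | ~~ a j].
    by apply/setP => j; rewrite !inE ffunE; case: eqP.
  by [].
congr (G _ + G _).
  congr #|pred_of_set _|; apply/setP => j; rewrite !inE.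
  by have [->|] := eqVneq j v; rewrite ?av ?andbF.
rewrite (cardsD1 v) !inE vA ffunE eqxx negbK av add1n; congr _.+1.
congr #|pred_of_set _|; apply/setP => j; rewrite !inE ffunE.
by have [->|] := eqVneq j v.
Qed.

(** * The binomial sum behind [alpha2] *)

(** Since (k+1) C(d,k+1) = (d-k) C(d,k), each term is (k+1) C(d,k+1) - k C(d,k). The bound on [j]
    keeps every truncated subtraction exact. *)
Lemma sum_bin_telescope (d j : nat) : (2 * j <= d.+2)%N ->
  (\sum_(k < j) (d - 2 * k) * 'C(d, k) = j * 'C(d, j))%N.
Proof.
elim: j => [|j IHj] le_j; first by rewrite big_ord0.
by rewrite big_ord_recr /= IHj ?mul_bin_left -?mulnDl; [congr (_ * _)%N|]; lia.
Qed.

Lemma sum_bin_subn (d : nat) :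
  (2 * \sum_(k < d.+1) (d - 2 * k) * 'C(d, k)
   = 2 ^ odd d * d * 'C(d./2.*2, d./2))%N.
Proof.
(* Truncation makes the terms with 2k > d vanish. *)
have -> : (\sum_(k < d.+1) (d - 2 * k) * 'C(d, k)
           = \sum_(k < d./2.+1) (d - 2 * k) * 'C(d, k))%N.
  have le_d : (d./2.+1 <= d.+1)%N by lia.
  rewrite (big_ord_widen _ (fun k => (d - 2 * k) * 'C(d, k))%N le_d).
  rewrite [RHS]big_mkcond /=; apply: eq_bigr => k _.
  by case: ifP => // lt_k; apply/eqP; rewrite muln_eq0; apply/orP; left; lia.
rewrite sum_bin_telescope; last by lia.
have [odd_d|even_d] := boolP (odd d).
  have dE : d = d./2.*2.+1 by lia.
  by rewrite -mulnA -mul_bin_diag [in d.-1]dE.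
have dE : d./2.*2 = d by lia.
by rewrite mul_bin_left mulnA mul1n dE; congr (_ * _)%N; lia.
Qed.

Lemma sum_bin_min (d : nat) :
  (2 * \sum_(k < d.+1) minn (2 * k) d * 'C(d, k)
   + 2 ^ odd d * d * 'C(d./2.*2, d./2) = 2 * (d * 2 ^ d))%N.
Proof.
rewrite -sum_bin_subn -mulnDr -big_split /=; congr (_ * _)%N.
rewrite (eq_bigr (fun k : 'I_d.+1 => d * 'C(d, k))%N) => [|k _]; last first.
  by rewrite -mulnDl; congr (_ * _)%N; lia.
rewrite -big_distrr /= -[2%N]/(1 + 1)%N expnDn; congr (_ * _)%N.
by apply: eq_bigr => k _; rewrite !exp1n !muln1.
Qed.

(** Rounding [d] down to an even number merges all three cases; for [d = 1] the formula gives 1/2 -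
    1/4. *)
Lemma alpha2E (R : realFieldType) (d : nat) : (0 < d)%N ->
  alpha2 R d = 1 / 2 - 1 / 2 ^+ (d./2.*2 + 2) * 'C(d./2.*2, d./2)%:R.
Proof.
have even_case (m : nat) : (0 < m)%N ->
    alpha2 R m.*2 = 1 / 2 - 1 / 2 ^+ (m.*2 + 2) * 'C(m.*2, m)%:R.
  case: m => // m _; rewrite doubleS /= negbK odd_double /=.
  by rewrite -doubleS divn2 doubleK.
case: d => [|[|d]] // _; first by rewrite /= bin0; field.
have [odd_d|even_d] := boolP (odd d.+2).
  have dE : d.+1 = d.+2./2.*2 by lia.
  have -> : alpha2 R d.+2 = alpha2 R d.+1.
    by rewrite [LHS]/= -[~~ ~~ odd d]/(odd d.+2) odd_d.
  by rewrite {1}dE even_case //; lia.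
have dE : d.+2 = d.+2./2.*2 by lia.
by rewrite {1}dE even_case.
Qed.

(** This says that [alpha2 R d * d] is half the expectation of min (2 X, d), cleared of
    denominators. *)
Lemma alpha2_sum_bin (R : realFieldType) (d : nat) : (0 < d)%N ->
  alpha2 R d * d%:R * 2 * 2 ^+ d
  = \sum_(k < d.+1) (minn (2 * k) d)%:R *+ 'C(d, k).
Proof.
move=> d_gt0.
under eq_bigr => k _ do rewrite -mulrnA.
rewrite -natr_sum.
have /(congr1 (fun k => k%:R : R)) := sum_bin_min d.
rewrite natrD !natrM !natrX => sumE.
rewrite alpha2E //; apply: (mulfI (_ : 2 != 0)); first by rewrite pnatr_eq0.
rewrite (canRL (addrK _) sumE) exprD.
have -> : 2 ^+ d = 2 ^+ odd d * 2 ^+ d./2.*2 :> R.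
  by rewrite -exprD odd_double_half.
have : 2 ^+ d./2.*2 != 0 :> R by rewrite expf_neq0 ?pnatr_eq0.
by move: (2 ^+ d./2.*2) => p p_neq0; field.
Qed.

(** * Lower bounds for the selected indegree *)

Lemma sum_unif_ge (R : realFieldType) (T : finType) (B : {set T})
    (X : T -> R) (c : R) :
  B != set0 -> {in B, forall i, c <= X i} -> c <= \sum_i unif R B i * X i.
Proof.
move=> B_neq0 leX.
rewrite (bigID (mem B)) /= [X in _ + X]big1 ?addr0; last first.
  by move=> i /negbTE iNB; rewrite /unif iNB mul0r.
have B_gt0 : 0 < #|B|%:R :> R by rewrite ltr0n card_gt0.
have -> : c = \sum_(i in B) #|B|%:R^-1 * c.
  by rewrite sumr_const -[RHS]mulr_natl mulrA divff ?mul1r ?gt_eqF.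
apply: ler_sum => i iB; rewrite /unif iB ler_wpM2l ?leX //.
by rewrite invr_ge0 ltW.
Qed.

Lemma argmax_from_neq0 (n : nat) (e : rel 'I_n) (S T : {set 'I_n}) :
  T != set0 -> argmax_from e S T != set0.
Proof.
case/set0Pn => i0 i0T; apply/set0Pn.
case: (arg_maxnP (indeg_from e S) i0T) => i iT max_i.
exists i; rewrite inE; apply/andP; split=> //.
by apply/forall_inP => j /max_i.
Qed.

Lemma indeg_from_le (n : nat) (e : rel 'I_n) (S T : {set 'I_n}) (i : 'I_n) :
  S \subset T -> (indeg_from e S i <= indeg_from e T i)%N.
Proof.
move=> /subsetP sST; apply/subset_leq_card/subsetP => j.
by rewrite !inE => /andP[/sST -> ->].
Qed.

(** Conditional expectation of the selected indegree, given the assignment [a]. *)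
Definition score (R : realFieldType) {n : nat} (e : rel 'I_n)
    (a : {ffun 'I_n -> bool}) : R :=
  \sum_i select R e a i * (indeg e i)%:R.

Lemma score_ge0 (R : realFieldType) (n : nat) (e : rel 'I_n)
    (a : {ffun 'I_n -> bool}) : 0 <= score R e a.
Proof.
apply: sumr_ge0 => i _; rewrite mulr_ge0 ?ler0n // /select /unif.
by case: ifP => _; case: ifP; rewrite ?invr_ge0 ?ler0n.
Qed.

Lemma score_ge (R : realFieldType) (n : nat) (e : rel 'I_n)
    (a : {ffun 'I_n -> bool}) (i0 : 'I_n) (c : nat) : a i0 ->
  {in argmax_from e [set i | ~~ a i] [set i | a i],
    forall i, (c <= indeg e i)%N} ->
  c%:R <= score R e a.
Proof.
move=> ai0 le_c; rewrite /score /select.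
have A2_neq0 : [set i | a i] != set0 by apply/set0Pn; exists i0; rewrite inE.
rewrite (negbTE A2_neq0); apply: sum_unif_ge; first exact: argmax_from_neq0.
by move=> i /le_c; rewrite ler_nat.
Qed.

Lemma score_ge_indeg_from (R : realFieldType) (n : nat) (e : rel 'I_n)
    (a : {ffun 'I_n -> bool}) (i0 : 'I_n) : a i0 ->
  (indeg_from e [set i | ~~ a i] i0)%:R <= score R e a.
Proof.
move=> ai0; apply: (score_ge _ _ _ _ i0) => // i.
rewrite inE => /andP[_ /forall_inP/(_ i0)]; rewrite inE => /(_ ai0) le_i.
exact/(leq_trans le_i)/indeg_from_le/subsetT.
Qed.

Lemma score_flip_ge (R : realFieldType) (n : nat) (e : rel 'I_n)
    (v : 'I_n) (a : {ffun 'I_n -> bool}) : irreflexive e ->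
  (minn (2 * indeg_from e [set i | ~~ a i] v) (indeg e v))%:R
  <= score R e a + score R e (flip v a).
Proof.
move=> irr; wlog av : a / a v => [wl|].
  have [/wl //|nav] := boolP (a v).
  have := wl (flip v a); rewrite flipK addrC ffunE eqxx => /(_ nav).
  congr (_%:R <= _); congr (minn (2 * _) _).
  (* Without a loop at [v], its own coin does not affect its indegree from A_1. *)
  congr #|pred_of_set _|; apply/setP => j; rewrite !inE ffunE.
  by have [->|//] := eqVneq j v; rewrite irr !andbF.
set X := indeg_from _ _ v.
have [/existsP[j /and3P[jv aj leXj]]|no_rival] :=
    boolP [exists j, [&& j != v, a j & X <= indeg_from e [set i | ~~ a i] j]%N].
  apply: (@le_trans _ _ (X%:R + X%:R)).
    by rewrite -natrD ler_nat; lia.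
  apply: lerD; first exact: score_ge_indeg_from.
  have faj : flip v a j by rewrite ffunE (negbTE jv).
  apply: le_trans (score_ge_indeg_from R _ e _ _ faj).
  (* The flip moves [v] into A_1, which can only raise the indegree of the rival [j] from A_1. *)
  rewrite ler_nat (leq_trans leXj) // indeg_from_le //.
  apply/subsetP => i; rewrite !inE ffunE.
  by have [->|//] := eqVneq i v; rewrite av.
(* Here [v] is the sole winner under [a], which already yields its full indegree; the flipped
   assignment, where A_2 may be empty, only needs a nonnegative score. *)
apply: (@le_trans _ _ ((indeg e v)%:R + 0)).
  by rewrite addr0 ler_nat geq_minr.
apply: lerD; last exact: score_ge0.
apply: (score_ge _ _ _ _ v) => // i.
rewrite !inE => /andP[ai /forall_inP/(_ v)]; rewrite inE => /(_ av) leXi.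
have [-> //|iv] := eqVneq i v.
by case/existsP: no_rival; exists i; rewrite iv ai.
Qed.

Lemma expectation_two_partition (R : realFieldType) (n : nat) (e : rel 'I_n) :
  expectation (two_partition R e) (fun i => (indeg e i)%:R) * 2 ^+ n
  = \sum_a score R e a.
Proof.
rewrite /expectation /two_partition.
under eq_bigr => i _ do rewrite mulr_suml.
rewrite exchange_big /= mulr_suml; apply: eq_bigr => a _.
rewrite mulr_suml /score; apply: eq_bigr => i _.
have -> : \prod_(j < n) unif R [set: bool] (a j) = (2 ^+ n)^-1.
  under eq_bigr => j _ do rewrite /unif inE cardsT card_bool.
  by rewrite prodr_const card_ord exprVn.
have : 2 ^+ n != 0 :> R by rewrite expf_neq0 ?pnatr_eq0.
by move: (2 ^+ n) => p p_neq0; field.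
Qed.

Theorem theorem1 (R : realFieldType) (n : nat) (hn : (1 <= n)%N)
  (e : rel 'I_n) (he : irreflexive e) (hD : (1 <= max_indeg e)%N) :
  alpha2 R (max_indeg e) * (max_indeg e)%:R
    <= expectation (two_partition R e) (fun i => (indeg e i)%:R).
Proof.
have [v maxE] : {v | max_indeg e = indeg e v}.
  by apply: bigop.eq_bigmax; rewrite card_ord.
rewrite maxE in hD *; set d := indeg e v in hD *.
have pow2_gt0 k : 0 < 2 ^+ k :> R by rewrite exprn_gt0.
(* The factor 2^n clears the assignment probabilities, 2 allows the pairing by [flip v], and 2^d
   clears the binomial law of X. *)
rewrite -(ler_pM2r (pow2_gt0 n)) expectation_two_partition.
rewrite -(ler_pM2r (pow2_gt0 1)) -(ler_pM2r (pow2_gt0 d)) expr1.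
have XE a : indeg_from e [set i | ~~ a i] v
            = #|[set j in [set j | e j v] | ~~ a j]|.
  by congr #|pred_of_set _|; apply/setP => j; rewrite !inE andbC.
have dE : #|[set j | e j v]| = d.
  by congr #|pred_of_set _|; apply/setP => j; rewrite !inE.
have := sum_card_fibre R _ [set j | e j v] (fun k => (minn (2 * k) d)%:R).
rewrite dE card_ord -alpha2_sum_bin // -[LHS]mulr_natr -[RHS]mulr_natr.
rewrite !natrX => sumE.
have -> : alpha2 R d * d%:R * 2 ^+ n * 2 * 2 ^+ d
          = alpha2 R d * d%:R * 2 * 2 ^+ d * 2 ^+ n by ring.
rewrite -sumE ler_pM2r // mulr_natr (sum_flip _ _ v).
by apply: ler_sum => a _; rewrite -XE; apply: score_flip_ge.
Qed.
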